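(* The preordering $\{\langle e,i\rangle: W_e\subseteq^* W_i\}$ on $\omega$ is $m$-complete for $\Sigma^0_3$ preorderings: it is a $\Sigma^0_3$ preordering, and for every $\Sigma^0_3$ preordering $\preceq$ on $\omega$ there is a computable function $f$ such that for all $n,k$, $n\preceq k\iff W_{f(n)}\subseteq^* W_{f(k)}$.
   Context: $W_e$ is the $e$-th computably enumerable set; $X\subseteq^* Y$ means $X\setminus Y$ is finite. *)

(* Defs.v *)
From mathcomp Require Import all_boot.
From mathcomp Require Import boolp classical_sets cardinality.
From Stdlib Require Cantor.
From Stdlib Require Export RelationClasses.

Set Implicit Arguments.
Unset Strict Implicit.
Unset Printing Implicit Defensive.

Local Open Scope classical_set_scope.

Definition pi (x y : nat) : nat := Cantor.to_nat (x, y).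
Definition pi1 (z : nat) : nat := (Cantor.of_nat z).1.
Definition pi2 (z : nat) : nat := (Cantor.of_nat z).2.

(* Syntax of the partial recursive functions. Every program is unary; several
   arguments are passed through the Cantor pairing [pi]. *)
Inductive code : Type :=
| Zero
| Succ
| Fst
| Snd
| Pair of code & code
| Comp of code & code
| Prec of code & code
| Mu of code.

(* Graph of h, where h(a, 0) ~ F(a) and h(a, n+1) ~ G(a, n, h(a, n)). *)
Fixpoint prec_graph (F G : nat -> nat -> Prop) (a n y : nat) : Prop :=
  match n with
  | 0 => F a y
  | m.+1 => exists2 i, prec_graph F G a m i & G (pi a (pi m i)) y
  end.

(* [eval c x y]: the program c halts on input x with output y. In the case of
   [Mu], all values before the zero found must be defined. *)
Fixpoint eval (c : code) (x y : nat) : Prop :=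
  match c with
  | Zero => y = 0
  | Succ => y = x.+1
  | Fst => y = pi1 x
  | Snd => y = pi2 x
  | Pair f g => exists a b, [/\ eval f x a, eval g x b & y = pi a b]
  | Comp f g => exists2 a, eval g x a & eval f a y
  | Prec f g => prec_graph (eval f) (eval g) (pi1 x) (pi2 x) y
  | Mu f => eval f (pi x y) 0 /\
            forall m, m < y -> exists k, eval f (pi x m) k.+1
  end.

Fixpoint godel (c : code) : nat :=
  match c with
  | Zero => pi 0 0
  | Succ => pi 1 0
  | Fst => pi 2 0
  | Snd => pi 3 0
  | Pair f g => pi 4 (pi (godel f) (godel g))
  | Comp f g => pi 5 (pi (godel f) (godel g))
  | Prec f g => pi 6 (pi (godel f) (godel g))
  | Mu f => pi 7 (godel f)
  end.

(* Domain of the e-th partial computable function, which is nowhere defined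
   if e is not the Goedel number of a program. *)
Definition W (e : nat) : set nat :=
  [set x | exists c y, godel c = e /\ eval c x y].

Definition computable (f : nat -> nat) : Prop :=
  exists c, forall x, eval c x (f x).

Definition Sigma03 (A : set nat) : Prop :=
  exists2 r : nat -> bool, computable (fun z => r z : nat) &
    forall x, A x <->
      exists a, forall b, exists c, r (pi x (pi a (pi b c))).

Definition Sigma03_rel (R : nat -> nat -> Prop) : Prop :=
  Sigma03 [set z | R (pi1 z) (pi2 z)].

Definition subset_star (X Y : set nat) : Prop := finite_set (X `\` Y).

Notation "X `<=*` Y" := (subset_star X Y) (at level 70, no associativity).

Lemma pi_inj a b c d : pi a b = pi c d -> a = c /\ b = d.
Proof. by move/Cantor.to_nat_inj=> [-> ->]. Qed.

Lemma godel_inj : injective godel.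
Proof.
elim=> [||||f IHf g IHg|f IHf g IHg|f IHf g IHg|f IHf] [||||f' g'|f' g'|f' g'|f'] //=;
  move/pi_inj => [] //= _.
- by move/pi_inj=> [/IHf -> /IHg ->].
- by move/pi_inj=> [/IHf -> /IHg ->].
- by move/pi_inj=> [/IHf -> /IHg ->].
- by move/IHf ->.
Qed.

Lemma eval_functional c x y z : eval c x y -> eval c x z -> y = z.
Proof.
elim: c x y z => [||||f IHf g IHg|f IHf g IHg|f IHf g IHg|f IHf] x y z /=;
  try by move=> -> ->.
- move=> [a [b [fa gb ->]]] [a' [b' [fa' gb' ->]]].
  by rewrite (IHf _ _ _ fa fa') (IHg _ _ _ gb gb').
- move=> [a ga fa] [a' ga' fa'].
  by move: fa'; rewrite -(IHg _ _ _ ga ga'); exact: IHf.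
- elim: (pi2 x) y z => [|n IHn] y z /=; first exact: IHf.
  by move=> [i hi gi] [j hj]; rewrite -(IHn _ _ hi hj); exact: IHg.
- move=> [fy ly] [fz lz]; case: (ltngtP y z) => // h.
  + by have [k /(IHf _ _ _ fy)] := lz _ h.
  + by have [k /(IHf _ _ _ fz)] := ly _ h.
Qed.

(* Main.v *)
(** The relation is Sigma_3 because [W e] is the projection of a decidable
    predicate: a computation is a finite set of facts "program e maps x to y",
    each justified by others in the set.

    For completeness, write [R m k] as "some witness [t = (m, k, a)] passes
    infinitely many tests". An element (L, S, j) guesses that the finite set
    [S], a subset of [0, L), is an upper set for [R], and that [j] is the largest
    number of tests passed by a witness [t < L] violated by [S], i.e. with
    [m] in [S] and [k] not in [S]. It is enumerated only after some such
    witness has passed [j] tests (or if [j = 0]), at first into the sets with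
    index in [S], and into all sets once some such witness passes [j + 1] tests.
    If [t = (m, k, a)] is a true witness, an element in the [m]-th but not in the
    [k]-th set has [L <= t], since otherwise the violated [t] would dump it; then
    [S] and [j] range over finite sets. If [R m k] fails, then for every large
    [L] the set [S] of all [i < L] with [R m i] violates only false witnesses,
    and with the correct [j] it yields an element in the difference. *)

Require Import Defs.
From mathcomp Require Import all_boot.
From mathcomp Require Import boolp classical_sets cardinality.
From mathcomp Require Import zify.
(* [all_boot] shadows [pi]. *)
Import Defs.

Set Implicit Arguments.
Unset Strict Implicit.
Unset Printing Implicit Defensive.

Local Open Scope classical_set_scope.

(** * Projections and bounds for the Cantor pairing *)

Lemma pi1E a b : pi1 (pi a b) = a.
Proof. by rewrite /pi1 /pi Cantor.cancel_of_to. Qed.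

Lemma pi2E a b : pi2 (pi a b) = b.
Proof. by rewrite /pi2 /pi Cantor.cancel_of_to. Qed.

Lemma piK z : pi (pi1 z) (pi2 z) = z.
Proof. by rewrite /pi1 /pi2 /pi -surjective_pairing Cantor.cancel_to_of. Qed.

Lemma leq_pi a b : a + b <= pi a b.
Proof. by have := Cantor.to_nat_non_decreasing a b; rewrite /pi; lia. Qed.

Lemma leq_pil a b : a <= pi a b.
Proof. exact: leq_trans (leq_addr b a) (leq_pi a b). Qed.

Lemma leq_pir a b : b <= pi a b.
Proof. exact: leq_trans (leq_addl a b) (leq_pi a b). Qed.

Lemma leq_pi1 z : pi1 z <= z.
Proof. by rewrite -{2}(piK z) leq_pil. Qed.

Lemma leq_pi2 z : pi2 z <= z.
Proof. by rewrite -{2}(piK z) leq_pir. Qed.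

(** * Computable functions *)

Definition Id := Pair Fst Snd.

Fixpoint Const n := if n is m.+1 then Comp Succ (Const m) else Zero.

Lemma eval_Id x : eval Id x x.
Proof. by exists (pi1 x), (pi2 x); rewrite piK. Qed.

Lemma eval_Const n x : eval (Const n) x n.
Proof. by elim: n => //= n IH; exists n. Qed.

Lemma computable_id : computable (fun z => z).
Proof. by exists Id; exact: eval_Id. Qed.

Lemma computable_const n : computable (fun=> n).
Proof. by exists (Const n); exact: eval_Const. Qed.

Lemma computable_comp f g :
  computable f -> computable g -> computable (fun z => f (g z)).
Proof. by move=> [c hc] [d hd]; exists (Comp c d) => x; exists (g x). Qed.

Lemma computable_S f : computable f -> computable (fun z => (f z).+1).
Proof. by apply: computable_comp; exists Succ. Qed.

Lemma computable_pi1 f : computable f -> computable (fun z => pi1 (f z)).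
Proof. by apply: computable_comp; exists Fst. Qed.

Lemma computable_pi2 f : computable f -> computable (fun z => pi2 (f z)).
Proof. by apply: computable_comp; exists Snd. Qed.

Lemma computable_pi f g :
  computable f -> computable g -> computable (fun z => pi (f z) (g z)).
Proof. by move=> [c hc] [d hd]; exists (Pair c d) => x; exists (f x), (g x). Qed.

Lemma eq_computable f g : f =1 g -> computable f -> computable g.
Proof. by move=> fg [c hc]; exists c => x; rewrite -fg. Qed.

(** [Prec] carries its parameter unchanged, so the count, the step and the start may all depend on
    [z]. The recursions below reduce to this one. *)
Lemma computable_iteri n (g : nat -> nat -> nat -> nat) f :
  computable n ->
  computable (fun u => g (pi1 u) (pi1 (pi2 u)) (pi2 (pi2 u))) ->
  computable f ->
  computable (fun z => iteri (n z) (g z) (f z)).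
Proof.
move=> hn [d hd] [c hc].
have hrec : computable (fun u => iteri (pi2 u) (g (pi1 u)) (f (pi1 u))).
  exists (Prec c d) => u /=; elim: (pi2 u) => [|m IH] /=; first exact: hc.
  eexists; first exact: IH.
  by have := hd (pi (pi1 u) (pi m (iteri m (g (pi1 u)) (f (pi1 u)))));
    rewrite !(pi1E, pi2E).
apply: (eq_computable _ (computable_comp hrec (computable_pi computable_id hn))).
by move=> z; rewrite pi1E pi2E.
Qed.

Lemma computable_iter n h f :
  computable n -> computable h -> computable f ->
  computable (fun z => iter (n z) h (f z)).
Proof.
move=> hn hh hf.
apply: (@eq_computable (fun z => iteri (n z) (fun=> h) (f z))).
  by move=> z; elim: (n z) => //= m ->.
apply: computable_iteri => //; apply: computable_comp => //.
by do 2!apply: computable_pi2; exact: computable_id.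
Qed.

Lemma computable_add f g :
  computable f -> computable g -> computable (fun z => f z + g z).
Proof.
move=> hf hg; apply: (@eq_computable (fun z => iter (f z) S (g z))).
  by move=> z; elim: (f z) => //= m ->.
by apply: computable_iter => //; exists Succ.
Qed.

Lemma computable_pred f : computable f -> computable (fun z => (f z).-1).
Proof.
move=> hf; apply: (@eq_computable (fun z => iteri (f z) (fun m _ => m) 0)).
  by move=> z; case: (f z).
apply: computable_iteri => //; last exact: computable_const.
by apply: computable_pi1; apply: computable_pi2; exact: computable_id.
Qed.

Lemma computable_sub f g :
  computable f -> computable g -> computable (fun z => f z - g z).
Proof.
move=> hf hg; apply: (@eq_computable (fun z => iter (g z) predn (f z))).
  by move=> z; elim: (g z) => [|m IH] /=; rewrite ?subn0 // IH subnS.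
by apply: computable_iter => //; apply: computable_pred; exact: computable_id.
Qed.

Lemma computable_eq0 f :
  computable f -> computable (fun z => (f z == 0) : nat).
Proof.
move=> hf; apply: (@eq_computable (fun z => 1 - f z)).
  by move=> z; case: (f z) => //= m; rewrite subSS sub0n.
by apply: computable_sub => //; exact: computable_const.
Qed.

Lemma computable_neg (b : nat -> bool) :
  computable (fun z => b z : nat) -> computable (fun z => ~~ b z : nat).
Proof.
move=> hb; apply: (eq_computable _ (computable_eq0 hb)).
by move=> z; case: (b z).
Qed.

Lemma computable_or (b c : nat -> bool) :
  computable (fun z => b z : nat) -> computable (fun z => c z : nat) ->
  computable (fun z => b z || c z : nat).
Proof.
move=> hb hc.
apply: (eq_computable _ (computable_neg (computable_eq0 (computable_add hb hc)))).
by move=> z; case: (b z) (c z) => [] [].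
Qed.

Lemma computable_and (b c : nat -> bool) :
  computable (fun z => b z : nat) -> computable (fun z => c z : nat) ->
  computable (fun z => b z && c z : nat).
Proof.
move=> hb hc.
apply: (eq_computable _ (computable_neg (computable_or (computable_neg hb)
  (computable_neg hc)))).
by move=> z; case: (b z) (c z) => [] [].
Qed.

Lemma computable_implb (b c : nat -> bool) :
  computable (fun z => b z : nat) -> computable (fun z => c z : nat) ->
  computable (fun z => (b z ==> c z) : nat).
Proof.
move=> hb hc; apply: (eq_computable _ (computable_or (computable_neg hb) hc)).
by move=> z; rewrite implybE.
Qed.

Lemma computable_leq f g :
  computable f -> computable g -> computable (fun z => (f z <= g z) : nat).
Proof. by move=> hf hg; apply: computable_eq0; exact: computable_sub. Qed.

Lemma computable_eq f g :
  computable f -> computable g -> computable (fun z => (f z == g z) : nat).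
Proof.
move=> hf hg; apply: (eq_computable _ (computable_and (computable_leq hf hg)
  (computable_leq hg hf))).
by move=> z; rewrite eqn_leq.
Qed.

Lemma computable_all (n : nat -> nat) (p : nat -> nat -> bool) :
  computable n -> computable (fun u => p (pi1 u) (pi2 u) : nat) ->
  computable (fun z => all (p z) (iota 0 (n z)) : nat).
Proof.
move=> hn hp.
(* The accumulator is the truth value of the conjunction so far, read back by [i != 0]. *)
apply: (@eq_computable (fun z =>
  iteri (n z) (fun m i => (i != 0) && p z m) 1)).
  move=> z; elim: (n z) => // m IH; rewrite -[in iota 0 _]addn1 iotaD all_cat.
  by rewrite /= IH -lt0n lt0b add0n andbT.
apply: computable_iteri => //; last exact: computable_const.
apply: computable_and.
  apply: computable_neg; apply: computable_eq0.
  by do 2!apply: computable_pi2; exact: computable_id.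
apply: (eq_computable _ (computable_comp hp (computable_pi
  (computable_pi1 computable_id)
  (computable_pi1 (computable_pi2 computable_id))))).
by move=> u; rewrite pi1E pi2E.
Qed.

Lemma computable_has (n : nat -> nat) (p : nat -> nat -> bool) :
  computable n -> computable (fun u => p (pi1 u) (pi2 u) : nat) ->
  computable (fun z => has (p z) (iota 0 (n z)) : nat).
Proof.
move=> hn hp; apply: (eq_computable _ (computable_neg
  (computable_all (p := fun z i => ~~ p z i) hn (computable_neg hp)))).
by move=> z; rewrite -has_predC; congr nat_of_bool; apply: eq_has => i /=;
  rewrite negbK.
Qed.

Lemma has_iotaP n (p : pred nat) :
  reflect (exists2 i, i < n & p i) (has p (iota 0 n)).
Proof.
by apply: (iffP hasP) => -[i]; rewrite ?mem_iota => hi pi; exists i;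
  rewrite ?mem_iota.
Qed.

Lemma all_iotaP n (p : pred nat) :
  reflect (forall i, i < n -> p i) (all p (iota 0 n)).
Proof.
by apply: (iffP allP) => h i hi; apply: h; move: hi; rewrite mem_iota.
Qed.

(** * Finite sets of numbers, coded by binary digits *)

Definition bit (w k : nat) : bool := odd (iter k half w).

Lemma computable_odd f : computable f -> computable (fun z => odd (f z) : nat).
Proof.
move=> hf; apply: (@eq_computable (fun z => iter (f z) (fun i => 1 - i) 0)).
  by move=> z; elim: (f z) => //= m ->; case: (odd m).
apply: computable_iter => //; last exact: computable_const.
by apply: computable_sub; [exact: computable_const | exact: computable_id].
Qed.

Lemma computable_half f : computable f -> computable (fun z => (f z)./2).
Proof.
move=> hf.
(* Half of [n], rounded down, is the number of odd [m < n]. *)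
apply: (@eq_computable (fun z => iteri (f z) (fun m i => odd m + i) 0)).
  by move=> z; elim: (f z) => //= m ->; rewrite uphalf_half.
apply: computable_iteri => //; last exact: computable_const.
apply: computable_add; last by do 2!apply: computable_pi2; exact: computable_id.
by apply: computable_odd; apply: computable_pi1; apply: computable_pi2;
  exact: computable_id.
Qed.

Lemma computable_iter_half f g : computable f -> computable g ->
  computable (fun z => iter (g z) half (f z)).
Proof.
move=> hf hg; apply: computable_iter => //.
by apply: computable_half; exact: computable_id.
Qed.

Lemma computable_bit f g : computable f -> computable g ->
  computable (fun z => bit (f z) (g z) : nat).
Proof. by move=> hf hg; apply: computable_odd; exact: computable_iter_half. Qed.

Ltac computability :=
  repeat first
    [ assumption | exact: computable_id | apply: computable_const
    | lazymatch goal with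
      | |- computable (fun z => nat_of_bool (@?b z && @?c z)) =>
          apply: computable_and
      | |- computable (fun z => nat_of_bool (@?b z || @?c z)) =>
          apply: computable_or
      | |- computable (fun z => nat_of_bool (@?b z ==> @?c z)) =>
          apply: computable_implb
      | |- computable (fun z => nat_of_bool (~~ @?b z)) =>
          apply: computable_neg
      | |- computable (fun z => nat_of_bool (all _ _)) => apply: computable_all
      | |- computable (fun z => nat_of_bool (has _ _)) => apply: computable_has
      | |- computable (fun z => nat_of_bool (bit _ _)) => apply: computable_bit
      | |- computable (fun z => nat_of_bool (_ <= _)) => apply: computable_leq
      | |- computable (fun z => nat_of_bool (_ == _)) => apply: computable_eq
      | |- computable (fun z => iter _ half _) => apply: computable_iter_half
      | |- computable pi1 => by exists Fst
      | |- computable pi2 => by exists Snd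
      | |- computable (fun z => pi _ _) => apply: computable_pi
      | |- computable (fun z => pi1 _) => apply: computable_pi1
      | |- computable (fun z => pi2 _) => apply: computable_pi2
      | |- computable (fun z => _.+1) => apply: computable_S
      | |- computable (fun z => _.-1) => apply: computable_pred
      end ].

(** Lets every search through a coded set be bounded by the code itself. *)
Lemma bit_ltn w k : bit w k -> k < w.
Proof.
rewrite /bit; elim: k w => [|k IH] w; first by case: w.
by rewrite iterSr => /IH; have := odd_double_half w; lia.
Qed.

(** The equation [iter n half w = 0] is the decidable form of: [w] codes a subset of [0, n). The
    bound leaves finitely many such codes. *)
Lemma iter_half_ltn n w : iter n half w = 0 -> w < 2 ^ n.
Proof.
elim: n w => [|n IH] w; first by move=> /= ->.
by rewrite iterSr => /IH; have := odd_double_half w; rewrite expnS; lia.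
Qed.

Lemma bit_geq n w k : iter n half w = 0 -> n <= k -> bit w k = false.
Proof.
move=> hw /subnK <-; rewrite /bit iterD hw.
by rewrite (_ : iter _ half 0 = 0) //; elim: (k - n) => //= m ->.
Qed.

Lemma exists_bitset n (p : pred nat) :
  exists2 w, iter n half w = 0 & forall k, k < n -> bit w k = p k.
Proof.
elim: n p => [|n IH] p; first by exists 0.
have [w hw wp] := IH (fun k => p k.+1).
exists (p 0 + w.*2) => [|[_|k]]; first by rewrite iterSr half_bit_double.
  by rewrite /bit /= oddD odd_double addbF oddb.
by rewrite /bit iterSr half_bit_double; exact: wp.
Qed.

Lemma exists_bitset_seq (s : seq nat) : exists w, bit w =1 mem s.
Proof.
have [n hn] : exists n, {in s, forall k, k < n}.
  exists (\max_(k <- s) k).+1 => k ks; rewrite ltnS.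
  exact: leq_bigmax_seq.
have [w hw wp] := exists_bitset n (mem s).
exists w => k; case: (ltnP k n) => [/wp //|nk].
rewrite (bit_geq hw nk); apply/esym/negbTE/negP => /= /hn.
by rewrite ltnNge nk.
Qed.

(** * The halting predicate *)

Definition prog (e : nat) : nat := pi e 0.

(* Never a [prog], since [0 < pi x y.+1]. *)
Definition fact (e x y : nat) : nat := pi e (pi x y.+1).

(** Well-formedness needs its own certificate: the base case of [Prec] does not run [g], yet an
    index counts only if it is the Goedel number of a whole program. *)
Inductive just_prog (B : pred nat) : nat -> Prop :=
| just_base t of t < 4 : just_prog B (pi t 0)
| just_binary t f g of 4 <= t < 7 & B (prog f) & B (prog g) :
    just_prog B (pi t (pi f g))
| just_unary f of B (prog f) : just_prog B (pi 7 f).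

(* One step of the evaluation rules, for programs given by Goedel numbers. *)
Inductive just (B : pred nat) : nat -> nat -> nat -> Prop :=
| just_Zero x : just B (pi 0 0) x 0
| just_Succ x : just B (pi 1 0) x x.+1
| just_Fst x : just B (pi 2 0) x (pi1 x)
| just_Snd x : just B (pi 3 0) x (pi2 x)
| just_Pair f g x a b of B (fact f x a) & B (fact g x b) :
    just B (pi 4 (pi f g)) x (pi a b)
| just_Comp f g x a y of B (fact g x a) & B (fact f a y) :
    just B (pi 5 (pi f g)) x y
| just_Prec0 f g a y of B (fact f a y) & B (prog g) :
    just B (pi 6 (pi f g)) (pi a 0) y
| just_PrecS f g a n i y of B (fact (pi 6 (pi f g)) (pi a n) i)
    & B (fact g (pi a (pi n i)) y) :
    just B (pi 6 (pi f g)) (pi a n.+1) y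
| just_Mu f x y of B (fact f (pi x y) 0)
    & (forall m, m < y -> exists k, B (fact f (pi x m) k.+1)) :
    just B (pi 7 f) x y.

(* Rules refer to smaller programs, or to the same one on a smaller recursion
   argument; hence a self-justifying set contains no circular derivation, and
   no order on its facts needs to be recorded. *)
Definition self_justifying (B : pred nat) : Prop :=
  (forall e, B (prog e) -> just_prog B e) /\
  (forall e x y, B (fact e x y) -> just B e x y).

(** * Soundness of self-justifying sets *)

Lemma sub_just_prog (A B : pred nat) e :
  subpred A B -> just_prog A e -> just_prog B e.
Proof. by move=> AB; case; econstructor; eauto. Qed.

Lemma sub_just (A B : pred nat) e x y :
  subpred A B -> just A e x y -> just B e x y.
Proof.
move=> AB; case; try by econstructor; eauto.
move=> f x' y' hf hm; apply: just_Mu; first exact: AB.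
by move=> m /hm [k /AB]; exists k.
Qed.

Lemma ltn_pi_arg t u : u < pi t.+1 u.
Proof. by have := leq_pi t.+1 u; lia. Qed.

Lemma ltn_pi_arg1 t f g : f < pi t.+1 (pi f g).
Proof. exact: leq_ltn_trans (leq_pil _ _) (ltn_pi_arg _ _). Qed.

Lemma ltn_pi_arg2 t f g : g < pi t.+1 (pi f g).
Proof. exact: leq_ltn_trans (leq_pir _ _) (ltn_pi_arg _ _). Qed.

Lemma ltn_pi_S a n : pi a n < pi a n.+1.
Proof.
have := Cantor.to_nat_spec a n; have := Cantor.to_nat_spec a n.+1.
by rewrite /pi; lia.
Qed.

Lemma just_prog_sound (B : pred nat) e : self_justifying B ->
  B (prog e) -> exists c, godel c = e.
Proof.
move=> [hB _]; elim/ltn_ind: e => e IH /hB he.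
move: he IH; case=> {e} [t t4|[//|t] f g t47 hf hg|f hf] IH.
- case: t t4 {IH} => [|[|[|[|//]]]] _.
  by exists Zero. by exists Succ. by exists Fst. by exists Snd.
- have [c <-] := IH _ (ltn_pi_arg1 _ _ _) hf.
  have [d <-] := IH _ (ltn_pi_arg2 _ _ _) hg.
  case: t t47 {IH} => [|[|[|[|[|[|t]]]]]] // _.
  by exists (Pair c d). by exists (Comp c d). by exists (Prec c d).
- by have [c <-] := IH _ (ltn_pi_arg _ _) hf; exists (Mu c).
Qed.

Lemma self_justifying_sound (B : pred nat) e x y : self_justifying B ->
  B (fact e x y) -> exists2 c, godel c = e & eval c x y.
Proof.
move=> hB; elim/ltn_ind: e x y => e IHe.
(* The inner induction, on the input, serves the recursive call of [Prec]. *)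
elim/ltn_ind => x IHx y /(proj2 hB) he.
move: he IHe IHx; case=> {e x y}
  [x|x|x|x|f g x a b hf hg|f g x a y hg hf|f g a y hf hg|f g a n i y hi hg
  |f x y hf hm] IHe IHx.
- by exists Zero.
- by exists Succ.
- by exists Fst.
- by exists Snd.
- have [c <- hc] := IHe _ (ltn_pi_arg1 _ _ _) _ _ hf.
  have [d <- hd] := IHe _ (ltn_pi_arg2 _ _ _) _ _ hg.
  by exists (Pair c d) => //; exists a, b.
- have [c <- hc] := IHe _ (ltn_pi_arg1 _ _ _) _ _ hf.
  have [d <- hd] := IHe _ (ltn_pi_arg2 _ _ _) _ _ hg.
  by exists (Comp c d) => //; exists a.
- have [c <- hc] := IHe _ (ltn_pi_arg1 _ _ _) _ _ hf.
  have [d <-] := just_prog_sound hB hg.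
  by exists (Prec c d) => //=; rewrite pi1E pi2E.
- have [d gd hd] := IHe _ (ltn_pi_arg2 _ _ _) _ _ hg.
  have [q gq] := IHx _ (ltn_pi_S _ _) _ hi.
  (* The tag 6 forces [q] to be a [Prec]; injectivity of [godel] then identifies its step program
     with [d]. *)
  case: q gq => [||||? ?|? ?|c d'|?] /= /pi_inj [] // _ /pi_inj [gc gd'].
  rewrite pi1E pi2E => hp.
  have dd' : d = d' by apply: godel_inj; rewrite gd gd'.
  exists (Prec c d); first by rewrite /= gc gd.
  by rewrite /= pi1E pi2E /=; exists i => //; rewrite dd'.
- have [c gc hc] := IHe _ (ltn_pi_arg _ _) _ _ hf.
  exists (Mu c); first by rewrite /= gc.
  split=> // m /hm [k /(IHe _ (ltn_pi_arg _ _)) [c' gc' hc']].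
  by exists k; rewrite (_ : c = c') //; apply: godel_inj; rewrite gc gc'.
Qed.

(** * Finite self-justifying sets for halting computations *)

Definition seq_justifying (s : seq nat) := self_justifying (mem s).

(** Justification is monotone in the available facts, so computations can be merged freely. *)
Lemma seq_justifying_cat s t :
  seq_justifying s -> seq_justifying t -> seq_justifying (s ++ t).
Proof.
move=> [sp sf] [tp tf].
have hs : subpred (mem s) (mem (s ++ t)) by move=> z /= zs; rewrite mem_cat zs.
have ht : subpred (mem t) (mem (s ++ t)).
  by move=> z /= zt; rewrite mem_cat zt orbT.
split=> [e|e x y] /=; rewrite mem_cat => /orP [].
- by move/sp/(sub_just_prog hs).
- by move/tp/(sub_just_prog ht).
- by move/sf/(sub_just hs).
- by move/tf/(sub_just ht).
Qed.

Lemma prog_neq_fact e e' x y : (prog e == fact e' x y) = false.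
Proof.
apply/negP => /eqP /pi_inj [_]; have := leq_pir x y.+1; lia.
Qed.

Lemma seq_justifying_fact s e x y : seq_justifying s -> just (mem s) e x y ->
  seq_justifying (fact e x y :: s).
Proof.
move=> [sp sf] hj.
have hs : subpred (mem s) (mem (fact e x y :: s)).
  by move=> z /= zs; rewrite inE zs orbT.
split=> [e'|e' x' y'] /=; rewrite inE => /orP [].
- by rewrite prog_neq_fact.
- by move/sp/(sub_just_prog hs).
- move/eqP/pi_inj => [-> /pi_inj [-> [->]]]; exact: sub_just hj.
- by move/sf/(sub_just hs).
Qed.

Lemma seq_justifying_prog s e : seq_justifying s -> just_prog (mem s) e ->
  seq_justifying (prog e :: s).
Proof.
move=> [sp sf] hj.
have hs : subpred (mem s) (mem (prog e :: s)).
  by move=> z /= zs; rewrite inE zs orbT.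
split=> [e'|e' x' y'] /=; rewrite inE => /orP [].
- by move/eqP/pi_inj => [-> _]; exact: sub_just_prog hj.
- by move/sp/(sub_just_prog hs).
- by rewrite eq_sym prog_neq_fact.
- by move/sf/(sub_just hs).
Qed.

Lemma just_prog_complete c :
  exists2 s, seq_justifying s & prog (godel c) \in s.
Proof.
have ext s e : seq_justifying s -> just_prog (mem s) e ->
    exists2 s, seq_justifying s & prog e \in s.
  move=> hs hj; exists (prog e :: s); first exact: seq_justifying_prog.
  exact: mem_head.
elim: c => [||||f [s hs fs] g [t ht gt]|f [s hs fs] g [t ht gt]
  |f [s hs fs] g [t ht gt]|f [s hs fs]];
  try by apply: (ext [::]) => //; exact: just_base.
1-3: apply: (ext (s ++ t)); first exact: seq_justifying_cat.
1-3: by apply: just_binary; rewrite //= mem_cat ?fs ?gt ?orbT.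
by apply: (ext s) => //; exact: just_unary.
Qed.

Lemma self_justifying_complete c x y : eval c x y ->
  exists2 s, seq_justifying s & fact (godel c) x y \in s.
Proof.
have ext s e x' y' : seq_justifying s -> just (mem s) e x' y' ->
    exists2 s, seq_justifying s & fact e x' y' \in s.
  move=> hs hj; exists (fact e x' y' :: s); first exact: seq_justifying_fact.
  exact: mem_head.
elim: c x y => [||||f IHf g IHg|f IHf g IHg|f IHf g IHg|f IHf] x y;
  try by move=> ->; apply: (ext [::]) => //; constructor.
- move=> [a [b [/IHf [s hs fs] /IHg [t ht gt] ->]]].
  apply: (ext (s ++ t)); first exact: seq_justifying_cat.
  by apply: just_Pair; rewrite //= mem_cat ?fs ?gt ?orbT.
- move=> [a /IHg [s hs fs] /IHf [t ht gt]].
  apply: (ext (s ++ t)); first exact: seq_justifying_cat.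
  by apply: (@just_Comp _ _ _ _ a); rewrite //= mem_cat ?fs ?gt ?orbT.
- move=> /=; rewrite -[x in fact _ x _]piK.
  elim: (pi2 x) y => [|n IHn] y /=.
    (* [g] is not run in the base case; [t] certifies that it is a program. *)
    move=> /IHf [s hs fs]; have [t ht gt] := just_prog_complete g.
    apply: (ext (s ++ t)); first exact: seq_justifying_cat.
    by apply: just_Prec0; rewrite //= mem_cat ?fs ?gt ?orbT.
  move=> [i /IHn [s hs fs] /IHg [t ht gt]].
  apply: (ext (s ++ t)); first exact: seq_justifying_cat.
  by apply: (@just_PrecS _ _ _ _ _ i); rewrite //= mem_cat ?fs ?gt ?orbT.
- move=> [/IHf [s hs fs] hm].
  (* The computations for all [m < y] are merged into one. *)
  have [t ht gt] : exists2 t, seq_justifying t &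
      forall m, m < y -> exists k, fact (godel f) (pi x m) k.+1 \in t.
    elim: y hm {s hs fs} => [|y IHy] hm; first by exists [::].
    have [|t ht gt] := IHy; first by move=> m my; apply: hm; exact: ltnW.
    have [k /IHf [s hs fs]] := hm y (ltnSn y).
    exists (s ++ t) => [|m]; first exact: seq_justifying_cat.
    rewrite ltnS leq_eqVlt => /orP [/eqP ->|/gt [l lt]].
      by exists k; rewrite mem_cat fs.
    by exists l; rewrite mem_cat lt orbT.
  apply: (ext (s ++ t)); first exact: seq_justifying_cat.
  apply: just_Mu => [|m /gt [k kt]]; first by rewrite /= mem_cat fs.
  by exists k; rewrite /= mem_cat kt orbT.
Qed.

(** * Decidability of self-justification *)

Definition just_progb (w e : nat) : bool :=
  [|| (pi1 e < 4) && (pi2 e == 0),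
      [&& 4 <= pi1 e, pi1 e < 7, bit w (prog (pi1 (pi2 e)))
        & bit w (prog (pi2 (pi2 e)))]
    | (pi1 e == 7) && bit w (prog (pi2 e))].

Lemma just_progP w e : reflect (just_prog (bit w) e) (just_progb w e).
Proof.
rewrite /just_progb; apply: (iffP idP) => [|[t t4|t f g /andP[t4 t7] hf hg|f hf]].
- case/or3P => [/andP[t4 /eqP u0]|/and4P[t4 t7 hf hg]|/andP[/eqP t7 hf]];
    rewrite -(piK e).
  + by rewrite u0; exact: just_base.
  + by rewrite -(piK (pi2 e)); apply: just_binary => //; rewrite t4.
  + by rewrite t7; exact: just_unary.
- by rewrite pi1E pi2E t4.
- by rewrite !(pi1E, pi2E) t4 t7 hf hg orbT.
- by rewrite !(pi1E, pi2E) hf !orbT.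
Qed.

Lemma ltn_fact_val e x y : y < fact e x y.
Proof.
by have := leq_pir e (pi x y.+1); have := leq_pi x y.+1; rewrite /fact; lia.
Qed.

(** The existentials of [just] become searches below [w]: each witness is at most the output of a
    fact in the set, hence below the code. *)
Definition justb (w e x y : nat) : bool :=
  let t := pi1 e in let u := pi2 e in let f := pi1 u in let g := pi2 u in
  has id
  [:: [&& t == 0, u == 0 & y == 0];
      [&& t == 1, u == 0 & y == x.+1];
      [&& t == 2, u == 0 & y == pi1 x];
      [&& t == 3, u == 0 & y == pi2 x];
      [&& t == 4, bit w (fact f x (pi1 y)) & bit w (fact g x (pi2 y))];
      (t == 5) &&
        has (fun a => bit w (fact g x a) && bit w (fact f a y)) (iota 0 w);
      [&& t == 6, pi2 x == 0, bit w (fact f (pi1 x) y) & bit w (prog g)];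
      [&& t == 6, pi2 x != 0 &
        has (fun i => bit w (fact e (pi (pi1 x) (pi2 x).-1) i) &&
          bit w (fact g (pi (pi1 x) (pi (pi2 x).-1 i)) y)) (iota 0 w)];
      [&& t == 7, bit w (fact u (pi x y) 0) &
        all (fun m => has (fun k => bit w (fact u (pi x m) k.+1)) (iota 0 w))
          (iota 0 y)]].

Lemma bit_fact_ltn w e x y : bit w (fact e x y) -> y < w.
Proof. by move/bit_ltn; apply: ltn_trans; exact: ltn_fact_val. Qed.

Lemma justP w e x y : reflect (just (bit w) e x y) (justb w e x y).
Proof.
apply: (iffP idP).
- rewrite /justb /=.
  rewrite -(piK e); move: (pi1 e) (pi2 e) => t u; rewrite !(pi1E, pi2E).
  case/orP => [/and3P[/eqP -> /eqP -> /eqP ->]|]; first exact: just_Zero.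
  case/orP => [/and3P[/eqP -> /eqP -> /eqP ->]|]; first exact: just_Succ.
  case/orP => [/and3P[/eqP -> /eqP -> /eqP ->]|]; first exact: just_Fst.
  case/orP => [/and3P[/eqP -> /eqP -> /eqP ->]|]; first exact: just_Snd.
  case/orP => [/and3P[/eqP -> hf hg]|].
    by rewrite -(piK u) -(piK y); exact: just_Pair.
  case/orP => [/andP[/eqP -> /has_iotaP [a _ /andP[hg hf]]]|].
    by rewrite -(piK u); exact: just_Comp hg hf.
  case/orP => [/and4P[/eqP -> /eqP x0 hf hg]|].
    by rewrite -(piK u) -(piK x) x0; exact: just_Prec0.
  case/orP => [/and3P[/eqP -> x0 /has_iotaP [i _ /andP[hi hg]]]|].
    rewrite -(piK x); case: (pi2 x) => [//|n] in x0 hi hg *.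
    by rewrite -(piK u) in hi *; move: hi hg; exact: just_PrecS.
  rewrite orbF => /and3P[/eqP -> hf /all_iotaP hm].
  by apply: just_Mu => // m /hm /has_iotaP [k _ hk]; exists k.
- case=> {e x y} [x|x|x|x|f g x a b hf hg|f g x a y hg hf|f g a y hf hg
    |f g a n i y hi hg|f x y hf hm]; rewrite /justb !(pi1E, pi2E) /= ?eqxx //.
  + by rewrite hf hg.
  + by rewrite orbF; apply/has_iotaP; exists a; rewrite ?hg //;
      exact: bit_fact_ltn hg.
  + by rewrite hf hg.
  + rewrite orbF; apply/has_iotaP; exists i; rewrite ?hi //.
    exact: bit_fact_ltn hi.
  + rewrite hf orbF /=; apply/all_iotaP => m /hm [k hk]; apply/has_iotaP.
    by exists k => //; apply: ltn_trans (bit_fact_ltn hk).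
Qed.

(** [pi2 z == 0] recognises the form [prog], and [pi2 (pi2 z) != 0] the form [fact], which stores
    the output plus one. Elements of neither form are unconstrained. *)
Definition self_justifyingb (w : nat) : bool :=
  all (fun z => bit w z ==>
    ((pi2 z == 0) ==> just_progb w (pi1 z)) &&
    ((pi2 (pi2 z) != 0) ==>
      justb w (pi1 z) (pi1 (pi2 z)) (pi2 (pi2 z)).-1)) (iota 0 w).

Lemma self_justifyingP w :
  reflect (self_justifying (bit w)) (self_justifyingb w).
Proof.
apply: (iffP (all_iotaP _ _)) => [h|[hp hf] z _].
  split=> [e|e x y] he; have /implyP/(_ he)/andP[] := h _ (bit_ltn he);
    rewrite !(pi1E, pi2E).
    by move=> /just_progP.
  by move=> _ /justP.
apply/implyP => hz; apply/andP; split; apply/implyP.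
  by move=> /eqP z0; apply/just_progP/hp; rewrite /prog -z0 piK.
case y0: (pi2 (pi2 z)) => [//|y] _; apply/justP/hf.
by rewrite /fact -y0 !piK.
Qed.

(* Kleene's predicate: [w] is a computation showing that program [e] halts
   on [x]. *)
Definition kleeneT (e x w : nat) : bool :=
  self_justifyingb w && has (fun y => bit w (fact e x y)) (iota 0 w).

Lemma W_kleeneT e x : W e x <-> exists w, kleeneT e x w.
Proof.
split=> [[c [y [<- /self_justifying_complete [s hs xs]]]]|[w]].
  have [w /funext ws] := exists_bitset_seq s; exists w.
  have hw : bit w (fact (godel c) x y) by rewrite ws.
  apply/andP; split; first by apply/self_justifyingP; rewrite ws.
  by apply/has_iotaP; exists y => //; exact: bit_fact_ltn hw.
move=> /andP[/self_justifyingP hw /has_iotaP [y _]].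
by move/(self_justifying_sound hw) => [c ce hc]; exists c, y.
Qed.

Lemma computable_kleeneT e x w :
  computable e -> computable x -> computable w ->
  computable (fun z => kleeneT (e z) (x z) (w z) : nat).
Proof.
move=> he hx hw.
have hT : computable (fun z => kleeneT (pi1 z) (pi1 (pi2 z)) (pi2 (pi2 z)) : nat).
  rewrite /kleeneT /self_justifyingb /just_progb /justb /fact /prog /=.
  by computability.
apply: (eq_computable _ (computable_comp hT
  (computable_pi he (computable_pi hx hw)))).
by move=> z; rewrite !(pi1E, pi2E).
Qed.

(** * Almost inclusion as a Sigma_3 preordering *)

Lemma finite_setP (A : set nat) :
  finite_set A <-> exists a, forall x, A x -> x < a.
Proof.
split=> [|[a ha]]; last first.
  by apply: (sub_finite_set (B := `I_a)) => // x /ha.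
move=> /finite_seqP [s ->]; exists (\max_(k <- s) k).+1 => x /= xs.
by rewrite ltnS; exact: leq_bigmax_seq.
Qed.

Lemma subset_star_preorder : PreOrder (fun e i => W e `<=*` W i).
Proof.
split=> [e|e i j ei ij]; first by rewrite /subset_star setDv; exact: finite_set0.
apply: (sub_finite_set (B := (W e `\` W i) `|` (W i `\` W j))).
  by move=> x [xe xj]; case: (pselect (W i x)) => xi; [right|left].
by rewrite finite_setU.
Qed.

(** Here [a] bounds the difference, [b] pairs an argument with a possible computation of the first
    program on it, and [c] is a computation of the second program on that argument. *)
Lemma subset_star_Sigma03 : Sigma03_rel (fun e i => W e `<=*` W i).
Proof.
exists (fun u => let z := pi1 u in let a := pi1 (pi2 u) in
    let b := pi1 (pi2 (pi2 u)) in let c := pi2 (pi2 (pi2 u)) in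
  [|| pi1 b < a, ~~ kleeneT (pi1 z) (pi1 b) (pi2 b)
    | kleeneT (pi2 z) (pi1 b) c]).
  apply: computable_or; first by computability.
  apply: computable_or.
    by apply: computable_neg; apply: computable_kleeneT; computability.
  by apply: computable_kleeneT; computability.
move=> z; rewrite /= /subset_star; rewrite finite_setP; split=> -[a ha]; exists a.
  move=> b; case: (ltnP (pi1 b) a) => [ba|ab].
    by exists 0; rewrite !(pi1E, pi2E) ba.
  case eT: (kleeneT (pi1 z) (pi1 b) (pi2 b)); last first.
    by exists 0; rewrite !(pi1E, pi2E) eT orbT.
  have /W_kleeneT [c hc] : W (pi2 z) (pi1 b).
    apply: contrapT => hn; suff : pi1 b < a by rewrite ltnNge ab.
    by apply: ha; split=> //; apply/W_kleeneT; exists (pi2 b).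
  by exists c; rewrite !(pi1E, pi2E) hc !orbT.
move=> x [/W_kleeneT [w hw] hx]; rewrite ltnNge; apply/negP => ax.
have [c] := ha (pi x w); rewrite !(pi1E, pi2E) ltnNge ax hw /= => hc.
by apply: hx; apply/W_kleeneT; exists c.
Qed.

(** * Completeness *)

Lemma computable_godel_Const : computable (fun k => godel (Const k)).
Proof.
apply: (@eq_computable
  (fun k => iter k (fun i => pi 5 (pi (pi 1 0) i)) (pi 0 0))).
  by elim=> //= k ->.
apply: computable_iter; [by computability | | by computability].
exact: computable_pi (computable_const 5)
  (computable_pi (computable_const _) computable_id).
Qed.

(** The program for [k] hard-wires [k] and searches for a stage with [Mu]; only the constant varies,
    so its Goedel number is computable from [k]. *)
Lemma exists_computable_index (P : nat -> nat -> nat -> bool) :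
  computable (fun u => P (pi1 (pi1 u)) (pi2 (pi1 u)) (pi2 u) : nat) ->
  exists2 f, computable f &
    forall k x, W (f k) x <-> exists s, P k x s.
Proof.
(* [Mu] searches for a zero, hence the negation. *)
move=> /computable_neg [d hd].
have dE k x s : eval d (pi (pi k x) s) (~~ P k x s).
  by have := hd (pi (pi k x) s); rewrite !(pi1E, pi2E).
exists (fun k => godel (Comp (Mu d) (Pair (Const k) Id))) => [|k x].
  have hC := computable_godel_Const.
  rewrite /godel -/godel; apply: computable_pi; computability.
split=> [[c [y [/godel_inj ->]]]|hP].
  move=> [_ [a [b [ha hb ->]]] [hy _]].
  rewrite (eval_functional ha (eval_Const k x)) in hy.
  rewrite (@eval_functional Id x b x hb (eval_Id x)) in hy.
  exists y; have := eval_functional hy (dE k x y).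
  by case: (P k x y).
(* The least stage is needed: [Mu] demands nonzero values before the zero found. *)
case: (ex_minnP hP) => s hs min_s.
exists (Comp (Mu d) (Pair (Const k) Id)), s; split=> //.
exists (pi k x); first by exists k, x; split; [exact: eval_Const|exact: eval_Id|].
split=> [|m ms]; first by have := dE k x s; rewrite hs.
exists 0; have := dE k x m; case hm: (P k x m) => //.
by have := min_s _ hm; rewrite leqNgt ms.
Qed.

(* [grows r t j]: the candidate witness [t = pi (pi m k) a] for [R m k] has
   passed its first [j] tests. *)
Definition grows (r : pred nat) (t j : nat) : Prop :=
  forall b, b < j -> exists c, r (pi (pi1 t) (pi (pi2 t) (pi b c))).

Definition violated (S t : nat) : bool :=
  bit S (pi1 (pi1 t)) && ~~ bit S (pi2 (pi1 t)).

Definition refuted (r : pred nat) (L S j : nat) : Prop :=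
  exists t, [/\ t < L, violated S t & grows r t j].

(* The number [pi (pi L S) j] stands for the guess that the set of bits of
   [S] is closed upwards as far as witnesses below [L] can tell, and that the
   largest number of tests passed by a violated witness below [L] is [j]. Once
   this number exceeds [j], the element is dumped into all sets. *)
Definition guess_set (r : pred nat) (k : nat) : set nat :=
  [set x | let L := pi1 (pi1 x) in let S := pi2 (pi1 x) in let j := pi2 x in
    [/\ iter L half S = 0, j = 0 \/ refuted r L S j
       & bit S k \/ refuted r L S j.+1]].

(** * Stage approximations and enumerability of the guess sets *)

Definition grows_at (r : pred nat) (s t j : nat) : bool :=
  all (fun b => has (fun c => r (pi (pi1 t) (pi (pi2 t) (pi b c)))) (iota 0 s))
    (iota 0 j).

Definition refuted_at (r : pred nat) (s L S j : nat) : bool :=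
  has (fun t => violated S t && grows_at r s t j) (iota 0 L).

Lemma grows_at_mono r s s' t j : s <= s' -> grows_at r s t j -> grows_at r s' t j.
Proof.
move=> ss' /all_iotaP h; apply/all_iotaP => b /h /has_iotaP [c cs hc].
by apply/has_iotaP; exists c => //; exact: leq_trans ss'.
Qed.

(** Finitely many tests have finitely many answers, and one stage exceeds them all. *)
Lemma growsP r t j : grows r t j <-> exists s, grows_at r s t j.
Proof.
split=> [|[s /all_iotaP h] b /h /has_iotaP [c _ hc]]; last by exists c.
elim: j => [|j IH] h; first by exists 0.
have [|s hs] := IH; first by move=> b bj; apply: h; exact: ltnW.
have [c hc] := h j (ltnSn j).
exists (maxn s c.+1); apply/all_iotaP => b.
rewrite ltnS leq_eqVlt => /orP [/eqP ->|bj].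
  by apply/has_iotaP; exists c => //; exact: leq_maxr.
by have /all_iotaP := grows_at_mono (leq_maxl s c.+1) hs; apply.
Qed.

Lemma refuted_at_mono r s s' L S j :
  s <= s' -> refuted_at r s L S j -> refuted_at r s' L S j.
Proof.
move=> ss' /has_iotaP [t tL /andP[vt ht]]; apply/has_iotaP; exists t => //.
by rewrite vt (grows_at_mono ss').
Qed.

Lemma refutedP r L S j : refuted r L S j <-> exists s, refuted_at r s L S j.
Proof.
split=> [[t [tL vt /growsP [s hs]]]|[s /has_iotaP [t tL /andP[vt ht]]]].
  by exists s; apply/has_iotaP; exists t; rewrite ?vt.
by exists t; split=> //; apply/growsP; exists s.
Qed.

Lemma guess_set_ce (r : pred nat) : computable (fun z => r z : nat) ->
  exists2 f, computable f & forall k, W (f k) = guess_set r k.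
Proof.
move=> hr; have [|f hf Wf] := @exists_computable_index (fun k x s =>
  let L := pi1 (pi1 x) in let S := pi2 (pi1 x) in let j := pi2 x in
  [&& iter L half S == 0, (j == 0) || refuted_at r s L S j
    & bit S k || refuted_at r s L S j.+1]).
  rewrite /refuted_at /grows_at /violated.
  by computability; apply: (computable_comp hr); computability.
exists f => // k; apply/seteqP; split=> x.
  move=> /Wf [s /and3P[/eqP h0 h1 h2]]; split=> //.
    by case/orP: h1 => [/eqP ->|h]; [left|right; apply/refutedP; exists s].
  by case/orP: h2 => [->|h]; [left|right; apply/refutedP; exists s].
move=> [h0 h1 h2]; apply/Wf.
have [s1 hs1] : exists s, (pi2 x == 0) ||
    refuted_at r s (pi1 (pi1 x)) (pi2 (pi1 x)) (pi2 x).
  case: h1 => [->|/refutedP [s hs]]; first by exists 0; rewrite eqxx.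
  by exists s; rewrite hs orbT.
have [s2 hs2] : exists s, bit (pi2 (pi1 x)) k ||
    refuted_at r s (pi1 (pi1 x)) (pi2 (pi1 x)) (pi2 x).+1.
  case: h2 => [->|/refutedP [s hs]]; first by exists 0.
  by exists s; rewrite hs orbT.
(* Refutations persist, so the later stage serves both conditions. *)
exists (maxn s1 s2); apply/and3P; split; first by rewrite h0.
  by case/orP: hs1 => [->//|/(refuted_at_mono (leq_maxl s1 s2)) ->]; rewrite orbT.
by case/orP: hs2 => [->//|/(refuted_at_mono (leq_maxr s1 s2)) ->]; rewrite orbT.
Qed.

(** * Verification of the reduction *)

Lemma leq_grows r t j j' : j <= j' -> grows r t j' -> grows r t j.
Proof. by move=> jj' h b bj; apply: h; exact: leq_trans jj'. Qed.

(** Each false candidate below [n] fails to pass some number [c] of tests, and [C] is the maximum of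
    such [c]. Which candidates are false is decided classically. *)
Lemma grows_bound r n :
  exists C, forall t, t < n -> grows r t C -> forall j, grows r t j.
Proof.
elim: n => [|n [C hC]]; first by exists 0.
case: (pselect (forall j, grows r n j)) => [hn|/existsNP [c hc]].
  by exists C => t; rewrite ltnS leq_eqVlt => /orP [/eqP -> //|/hC].
exists (maxn C c) => t; rewrite ltnS leq_eqVlt => /orP [/eqP ->|/hC h].
  by move/(leq_grows (leq_maxr C c)).
by move/(leq_grows (leq_maxl C c)).
Qed.

Lemma guess_set_sub r m k a : (forall j, grows r (pi (pi m k) a) j) ->
  guess_set r m `<=*` guess_set r k.
Proof.
move=> hg; set t0 := pi (pi m k) a; have [C hC] := grows_bound r t0.
(* Guesses in the difference have [L <= t0], hence [S < 2 ^ t0], and [j <= C]. *)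
apply: (sub_finite_set (B :=
  (fun p : (nat * nat) * nat => pi (pi p.1.1 p.1.2) p.2)
  @` ((`I_t0.+1 `*` `I_(2 ^ t0)) `*` `I_C.+1))); last first.
  apply: finite_image; apply: finite_setX; last exact: finite_II.
  by apply: finite_setX; exact: finite_II.
move=> x [[h0 h1 h2] /= hk].
have hd : ~ refuted r (pi1 (pi1 x)) (pi2 (pi1 x)) (pi2 x).+1.
  by move=> hd; apply: hk; split=> //; right.
have hbk : ~~ bit (pi2 (pi1 x)) k.
  by apply/negP => hb; apply: hk; split=> //; left.
have {h2} hbm : bit (pi2 (pi1 x)) m by case: h2.
have hL : pi1 (pi1 x) <= t0.
  rewrite leqNgt; apply/negP => hL; apply: hd; exists t0; split=> //.
  by rewrite /violated /t0 !(pi1E, pi2E) hbm hbk.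
exists ((pi1 (pi1 x), pi2 (pi1 x)), pi2 x); last by rewrite /= !piK.
split=> /=; first split=> /=; rewrite ?ltnS //.
  by apply: leq_trans (iter_half_ltn h0) _; rewrite leq_exp2l.
(* For [j] beyond [C], a candidate that passed [j] tests passes all of them, so it would dump
   [x]. *)
case: h1 => [-> //|[t [tL vt ht]]]; rewrite leqNgt; apply/negP => hj.
apply: hd; exists t; split=> //; apply: hC; first exact: leq_trans hL.
exact: leq_grows (ltnW hj) ht.
Qed.

Lemma guess_set_nsub r (R : nat -> nat -> Prop) m k : PreOrder R ->
  (forall m k a, (forall j, grows r (pi (pi m k) a) j) -> R m k) ->
  ~ R m k -> ~ guess_set r m `<=*` guess_set r k.
Proof.
move=> [Rrefl Rtrans] hR nR /finite_setP [a ha].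
(* [L] reaches the supposed bound [a] on the difference and exceeds [m] and [k], so that [S] decides
   both. *)
set L := maxn a (maxn m k).+1.
have mL : m < L by rewrite /L; lia.
have kL : k < L by rewrite /L; lia.
have [S hS SR] := exists_bitset L (fun i => `[< R m i >]).
have vfin t : t < L -> violated S t -> exists j, ~ grows r t j.
  move=> tL /andP[]; set m' := pi1 (pi1 t); set k' := pi2 (pi1 t).
  have m'L : m' < L.
    by apply: leq_ltn_trans tL; exact: leq_trans (leq_pi1 _) (leq_pi1 _).
  have k'L : k' < L.
    by apply: leq_ltn_trans tL; exact: leq_trans (leq_pi2 _) (leq_pi1 _).
  (* A true violated witness would give [R m k'] by transitivity, putting [k'] into [S]. *)
  rewrite !SR // => /asboolP mm' /asboolP mk'; apply/existsNP => hg.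
  apply: mk'; apply: (Rtrans _ _ _ mm'); apply: (hR _ _ (pi2 t)) => j.
  by rewrite !piK.
(* Violated candidates below [L] are all false, so none passes [C.+1] tests. *)
have hex : exists j, `[< ~ refuted r L S j.+1 >].
  have [C hC] := grows_bound r L; exists C; apply/asboolP => -[t [tL vt ht]].
  have [j] := vfin _ tL vt; apply; apply: hC => //.
  exact: leq_grows (leqnSn C) ht.
(* Minimality makes [j] exact: either [j = 0] or some violated candidate passes [j] tests, while
   none passes [j.+1]. *)
case: (ex_minnP hex) => j /asboolP hj min_j.
have h1 : j = 0 \/ refuted r L S j.
  case: j hj min_j => [|j] hj min_j; [by left|right].
  apply: contrapT => h; have := min_j j; rewrite ltnn => h'.
  by have := h' (asboolT h).
(* The guess is at least [L], hence at least [a], yet lies in the difference. *)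
have := ha (pi (pi L S) j); rewrite ltnNge => /(_ _)/negP; apply; last first.
  apply: leq_trans (leq_pil _ _); apply: leq_trans (leq_pil _ _).
  exact: leq_maxl.
split.
  rewrite /guess_set /= !(pi1E, pi2E); split=> //; left.
  by rewrite SR //; apply/asboolP; exact: Rrefl.
rewrite /guess_set /= !(pi1E, pi2E) => -[_ _ [|//]].
by rewrite SR // => /asboolP.
Qed.

Theorem mainTheorem20 :
  (PreOrder (fun e i => W e `<=*` W i) /\
   Sigma03_rel (fun e i => W e `<=*` W i)) /\
  (forall R : nat -> nat -> Prop, PreOrder R -> Sigma03_rel R ->
     exists f : nat -> nat, computable f /\
       forall n k, R n k <-> W (f n) `<=*` W (f k)).
Proof.
split=> [|R preR [r hr hR]].
  by split; [exact: subset_star_preorder | exact: subset_star_Sigma03].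
have growsR m k : R m k <-> exists a, forall j, grows r (pi (pi m k) a) j.
  have := hR (pi m k); rewrite /= pi1E pi2E => ->.
  split=> -[a ha]; exists a; first by move=> j b _; rewrite pi1E pi2E.
  (* Test number [b] is among the first [b.+1] tests. *)
  by move=> b; have := ha b.+1 b (ltnSn b); rewrite pi1E pi2E.
have [f hf Wf] := guess_set_ce hr.
exists f; split=> // n k; rewrite !Wf; split.
  by move=> /growsR [a]; exact: guess_set_sub.
move=> hs; apply: contrapT => nR.
apply: (guess_set_nsub preR _ nR hs) => m' k' a ha.
by apply/growsR; exists a.
Qed.
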